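(* Let $\bar u_0$ be a solution of $(\mathbb P_0)$ with $\operatorname{meas}(\{x\in\Omega_U:B^*\bar p_0(x)=0\})=0$ (a bang-bang solution). Let $\kappa>1$. Assume that $T^*:\operatorname{range}(T)\to L^\infty(\Omega_U)$ exists and is continuous (i.e. $T^*v\in L^\infty(\Omega_U)$ and $\|T^*v\|_{L^\infty(\Omega_U)}\le c\,\|v\|_H$ for all $v\in\operatorname{range}(T)\subset H$, with some constant $c>0$), and assume the $\sigma$-condition: there is $\sigma>0$ such that $a(x)\le-\sigma<0<\sigma\le b(x)$ for almost all $x\in\Omega_U$. Then the following two measure conditions with exponent $\kappa$ are equivalent: ($\bar p_0$-measure condition on $\Omega_U$) there is a constant $C\ge0$ with $\operatorname{meas}(\{x\in\Omega_U:0\le|B^*\bar p_0(x)|\le\epsilon\})\le C\epsilon^\kappa$ for all $\epsilon>0$; ($\bar p_\alpha$-measure condition) there are $\bar\alpha>0$ and a constant $C$ such that $\operatorname{meas}(\{x\in\Omega_U:\alpha a(x)<-B^*\bar p_\alpha(x)<\alpha b(x)\})\le C\alpha^\kappa$ for all $0<\alpha<\bar\alpha$.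
   Context: Setting. $\Omega_U\subset\mathbb R^n$, $n\ge1$, is a bounded measurable domain, $U:=L^2(\Omega_U)$ (real-valued), $H$ is an arbitrary (real) Hilbert space, $z\in H$ is fixed, and $T:U\to H$ is linear and continuous, written as $T=SB$ with continuous linear operators $B:U\to R$, $S:R\to H$ for some function space $R$ (always possible, e.g. $B=\mathrm{Id}$, $S=T$). Adjoints are denoted by $^*$, and $U$, $H$ are identified with their duals. Bounds $a,b\in L^\infty(\Omega_U)$ with $a\le b$ are given and $U_{\rm ad}:=\{u\in U: a(x)\le u(x)\le b(x)\text{ for almost all }x\in\Omega_U\}$. For $\alpha\ge0$, problem $(\mathbb P_\alpha)$ is $\min_{u\in U_{\rm ad}}\ \frac12\|Tu-z\|_H^2+\frac\alpha2\|u\|_U^2$. It has at least one solution $\bar u_\alpha$, which is unique if $\alpha>0$. Put $\bar y_\alpha:=T\bar u_\alpha$ and $\bar p_\alpha:=S^*(\bar y_\alpha-z)$, so that $B^*\bar p_\alpha=T^*(T\bar u_\alpha-z)\in U$; $\bar y_\alpha$ and $\bar p_\alpha$ are unique for every $\alpha\ge0$. Convention for $\kappa=\infty$: the $\bar p_0$-measure condition with $\kappa=\infty$ means that its left-hand side is zero for some $\epsilon>0$; the $\bar p_\alpha$-measure condition with $\kappa=\infty$ means that there is $\bar\alpha>0$ such that the measure in it is zero for all $0<\alpha<\bar\alpha$. *)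

(* Defs.v *)
From HB Require Import structures.
From mathcomp Require Import all_boot all_order all_algebra.
From mathcomp Require Import all_classical all_reals all_analysis.

Set Implicit Arguments.
Unset Strict Implicit.
Unset Printing Implicit Defensive.

Import Order.TTheory GRing.Theory Num.Theory.
Import numFieldNormedType.Exports.

Local Open Scope classical_set_scope.
Local Open Scope ring_scope.

(* The library has Lebesgue measure on the line only.  In dimension n+1 it is
   obtained here by Caratheodory's construction from coverings by countably
   many half-open boxes, so that the measurable sets are the
   Lebesgue-measurable ones (the measure is complete). *)
Section lebesgue_measure_rV.
Context {R : realType} {n : nat}.
Local Notation E := 'rV[R]_n.+1.

(* A box is given by its lower and upper corners; it is empty, of volume 0,
   unless the lower corner lies strictly below the upper one. *)
Definition box (c : E * E) : set E :=
  [set x | forall i, c.1 ord0 i < x ord0 i <= c.2 ord0 i].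

Definition box_volume (c : E * E) : R :=
  \prod_(i < n.+1) Num.max 0 (c.2 ord0 i - c.1 ord0 i).

Definition box_cover (A : set E) : set (nat -> E * E) :=
  [set c | A `<=` \bigcup_k box (c k)].

Definition lebesgue_outer (A : set E) : \bar R :=
  ereal_inf [set (\sum_(k <oo) (box_volume (c k))%:E)%E | c in box_cover A].

Lemma box_volume_ge0 c : 0 <= box_volume c.
Proof. by apply: prodr_ge0 => i _; rewrite le_max lexx. Qed.

Let vol_ge0 c : (0 <= (box_volume c)%:E)%E.
Proof. by rewrite lee_fin box_volume_ge0. Qed.

Lemma box_volume0 : box_volume 0 = 0.
Proof. by rewrite /box_volume big_ord_recl !mxE subrr maxxx mul0r. Qed.

Local Open Scope ereal_scope.

Lemma lebesgue_outer_ge0 A : 0 <= lebesgue_outer A.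
Proof. by apply: le_ereal_inf_tmp => _ [c _ <-]; exact: nneseries_ge0. Qed.

Lemma lebesgue_outer0 : lebesgue_outer set0 = 0.
Proof.
apply/eqP; rewrite eq_le lebesgue_outer_ge0 andbT.
apply: ereal_inf_lbound; exists (fun=> 0%R); first exact: sub0set.
by rewrite eseries0// => k _ _; rewrite box_volume0.
Qed.

Lemma le_lebesgue_outer : {homo lebesgue_outer : A B / A `<=` B >-> A <= B}.
Proof.
move=> A B AB; apply/ereal_inf_le_tmp => _ [c Bc <-].
by exists c => //; exact: subset_trans Bc.
Qed.

Lemma lebesgue_outer_sigma_subadditive : sigma_subadditive lebesgue_outer.
Proof.
move=> A; have [[i ioo]|] := pselect (exists i, lebesgue_outer (A i) = +oo).
  rewrite (eseries_pinfty _ _ ioo) ?leey// => k _.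
  by rewrite -ltNye (lt_le_trans _ (lebesgue_outer_ge0 _)).
rewrite -forallNE => Aoo.
suff add2e (e : {posnum R}) :
    lebesgue_outer (\bigcup_n A n) <=
    \sum_(i <oo) lebesgue_outer (A i) + e%:num%:E.
  by apply/lee_addgt0Pr => _/posnumP[].
rewrite (le_trans _ (epsilon_trick _ _ _))//; last first.
  by move=> k; exact: lebesgue_outer_ge0.
pose P k (c : nat -> E * E) := box_cover (A k) c /\
  \sum_(j <oo) (box_volume (c j))%:E <=
  lebesgue_outer (A k) + (e%:num / (2 ^ k.+1)%:R)%:E.
have [G PG] : {G : nat -> nat -> E * E & forall k, P k (G k)}.
  apply: (@choice _ _ P) => k; rewrite /P /lebesgue_outer.
  set S := (X in ereal_inf X); move infS : (ereal_inf S) => iS.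
  case: iS infS => [r Sr|Soo|Soo].
  - have en1 : (0 < e%:num / (2 ^ k.+1)%:R)%R by [].
    have /(lb_ereal_inf_adherent en1) : ereal_inf S \is a fin_num by rewrite Sr.
    move=> [x [B AnB muBx] xS].
    by exists B; split => //; rewrite muBx -Sr; exact/ltW.
  - by have := Aoo k; rewrite /lebesgue_outer Soo.
  - suff : lbound S 0 by move/le_ereal_inf_tmp; rewrite Soo.
    by move=> /= _ [B AnB <-]; exact: nneseries_ge0.
pose vol c := (box_volume c)%:E.
have volG_ge0 x : 0 <= (vol \o uncurry G) x by exact: vol_ge0.
apply: (@le_trans _ _ (\esum_(i in setT) (vol \o uncurry G) i)).
  apply: ereal_inf_lbound => /=.
  have /card_esym/ppcard_eqP[f] := card_nat2.
  exists (uncurry G \o f).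
    apply: (@subset_trans _ (\bigcup_n \bigcup_k box (G n k))) => [t [i _]|].
      by move=> /((PG i).1) -[j _ ?]; exists i => //; exists j.
    move=> t [i _ [j _ Bijt]]; exists (f^-1%FUN (i, j)) => //=.
    by rewrite invK ?inE.
  rewrite -(esum_pred_image (vol \o uncurry G) _ xpredT) ?[fun=> _]set_true//.
  by rewrite image_eq.
rewrite (_ : esum _ _ = \sum_(i <oo) \sum_(j <oo ) vol (G i j)); last first.
  pose J : nat -> set (nat * nat) := fun i => [set (i, j) | j in setT].
  rewrite (_ : setT = \bigcup_k J k); last first.
    by rewrite predeqE => -[a b]; split => // _; exists a => //; exists b.
  rewrite esum_bigcupT /=; last 2 first.
    - apply/trivIsetP => i j _ _ ij.
      rewrite predeqE => -[k m] /=; split => //= -[] [_] _ [<-{k} _].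
      by move=> [m' _] [] /esym/eqP; rewrite (negbTE ij).
    - by move=> /= [k m]; exact: vol_ge0.
  rewrite -(image_id [set: nat]) -fun_true esum_pred_image//; last first.
    by move=> k _; apply: esum_ge0 => i _; exact: vol_ge0.
  apply: eq_eseriesr => /= j _.
  rewrite -(esum_pred_image (vol \o uncurry G) (pair j) predT)//=; last 2 first.
    - by move=> k _; exact: vol_ge0.
    - by move=> ? ? _ _; exact: (@can_inj _ _ _ snd).
  by congr esum; rewrite predeqE => -[a b]; split; move=> [i _ <-]; exists i.
apply: lee_lim.
- apply: is_cvg_nneseries => k *.
  by apply: nneseries_ge0 => m *; exact: (volG_ge0 (k, m)).
- apply: is_cvg_nneseries => k *; apply: adde_ge0 => //.
  exact: lebesgue_outer_ge0.
- by near=> k; apply: lee_sum => i _; exact: (PG i).2.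
Unshelve. all: by end_near. Qed.

HB.instance Definition _ := isOuterMeasure.Build R E lebesgue_outer
  lebesgue_outer0 lebesgue_outer_ge0 le_lebesgue_outer
  lebesgue_outer_sigma_subadditive.

End lebesgue_measure_rV.

Notation lebesgue_space R n :=
  (caratheodory_type (@lebesgue_outer R n)).

Definition lebesgue_measure_rV (R : realType) (n : nat) :
  set (lebesgue_space R n) -> \bar R := @lebesgue_outer R n.

HB.instance Definition _ (R : realType) (n : nat) :=
  isMeasure.Build _ _ _ (@lebesgue_measure_rV R n)
    (@caratheodory_measure0 R _ (@lebesgue_outer R n))
    (@caratheodory_measure_ge0 R _ (@lebesgue_outer R n))
    (@caratheodory_measure_sigma_additive R _ (@lebesgue_outer R n)).

(* Lebesgue measure on a measurable subset D, as a measure on the whole space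
   that ignores the complement of D.  Consequently "almost everywhere", the
   L^p-norms and the integrals for this measure are those of D, and the values
   outside D of a function on the whole space are irrelevant. *)
Definition lebesgue_on (R : realType) (n : nat) (D : set (lebesgue_space R n))
    (mD : measurable D) : {measure set (lebesgue_space R n) -> \bar R} :=
  mrestr (@lebesgue_measure_rV R n) mD.

(* [L2 mu] is the library's vector space of square-integrable functions, not
   quotiented by equality almost everywhere: [L2_norm] is only a seminorm.
   Linear maps into a normed space that are continuous for this seminorm are
   the same as continuous linear maps on the quotient. *)
Notation L2 mu := (LfunType mu (lee1n 2)).

Section L2.
Context d {T : measurableType d} {R : realType}.
Variable mu : {measure set T -> \bar R}.

Definition L2_norm (u : L2 mu) : R := fine 'N[mu]_2%:R%:E[EFin \o u].

Definition L2_dot (u v : L2 mu) : R := \int[mu]_x (u x * v x).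

Definition L2_continuous (V : normedModType R) (F : L2 mu -> V) :=
  forall (u : L2 mu) (e : R), 0 < e -> exists2 r : R, 0 < r &
    forall v : L2 mu, L2_norm (v - u) < r -> `|F v - F u| < e.

Definition Linf (f : T -> R) := f \in Lfun mu +oo%E.
(* Meaningful only for f in L^oo: [fine] sends an infinite norm to 0. *)
Definition Linf_norm (f : T -> R) : R := fine 'N[mu]_+oo[EFin \o f].

End L2.

(* A real Hilbert space is a complete normed space whose norm is induced by an
   inner product. *)
Definition induces_norm (R : realType) (H : completeNormedModType R)
  (dot : {dot H for idfun}) := forall x : H, dot x x = `|x| ^+ 2.

Section adjoints.
Context d {T : measurableType d} {R : realType}.
Variable mu : {measure set T -> \bar R}.
Context (V : normedModType R) (H : completeNormedModType R).
Variable dot : {dot H for idfun}.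

Definition dual : set (V -> R) := [set q : V -> R | scalar q /\ continuous q].

(* S^* : H -> V', where H is identified with its dual. *)
Definition adjoint_to_dual (S : V -> H) (h : H) : V -> R :=
  fun r => dot h (S r).

(* Bs = B^* : V' -> L^2, where L^2 is identified with its dual; this determines
   Bs q up to equality almost everywhere.  Only the values of Bs on the dual
   of V matter. *)
Definition is_adjoint_from_dual (B : L2 mu -> V) (Bs : (V -> R) -> L2 mu) :=
  forall q, dual q -> forall u, L2_dot (Bs q) u = q (B u).

(* Fs = F^* : H -> L^2, both spaces being identified with their duals. *)
Definition is_adjoint (F : L2 mu -> H) (Fs : H -> L2 mu) :=
  forall h u, L2_dot (Fs h) u = dot h (F u).

End adjoints.

Section problem.
Context d {X : measurableType d} {R : realType}.
Variable mu : {measure set X -> \bar R}.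
Variables a b : X -> R.

Definition admissible : set (L2 mu) :=
  [set u | \forall x \ae mu, a x <= u x <= b x].

Context (H : completeNormedModType R).
Variables (T : L2 mu -> H) (z : H).

Definition objective (alpha : R) (u : L2 mu) : R :=
  2^-1 * `|T u - z| ^+ 2 + alpha / 2 * L2_norm u ^+ 2.

Definition is_solution (alpha : R) (u : L2 mu) :=
  admissible u /\
  forall v, admissible v -> objective alpha u <= objective alpha v.

End problem.

(* The exponent kappa ranges over the extended reals, and kappa = +oo has its
   own meaning; kappa = -oo never occurs, as kappa > 1. *)
Section measure_conditions.
Context d {X : measurableType d} {R : realType}.
Variable mu : {measure set X -> \bar R}.

(* q0 stands for B^* pbar_0. *)
Definition p0_measure_condition (q0 : X -> R) (kappa : \bar R) : Prop :=
  let M (eps : R) := mu [set x | 0 <= `|q0 x| <= eps] in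
  match kappa with
  | k%:E => exists2 C : R, 0 <= C &
      forall eps : R, 0 < eps -> (M eps <= (C * eps `^ k)%:E)%E
  | +oo%E => exists2 eps : R, 0 < eps & M eps = 0%E
  | -oo%E => False
  end.

(* q alpha stands for B^* pbar_alpha. *)
Definition palpha_measure_condition (a b : X -> R) (q : R -> X -> R)
    (kappa : \bar R) : Prop :=
  let M (alpha : R) :=
    mu [set x | alpha * a x < - q alpha x < alpha * b x] in
  match kappa with
  | k%:E => exists2 abar : R, 0 < abar & exists C : R,
      forall alpha : R, 0 < alpha < abar ->
        (M alpha <= (C * alpha `^ k)%:E)%E
  | +oo%E => exists2 abar : R, 0 < abar &
      forall alpha : R, 0 < alpha < abar -> M alpha = 0%E
  | -oo%E => False
  end.

End measure_conditions.

(* Main.v *)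
Require Import Defs.
From HB Require Import structures.
From mathcomp Require Import all_boot all_order all_algebra.
From mathcomp Require Import all_classical all_reals all_analysis.
From mathcomp Require Import measurable_realfun ess_sup_inf.
From mathcomp Require Import ring lra.

(* Write q_alpha = B^* pbar_alpha, u_alpha = ubar_alpha, and let M bound |a| and
   |b|.  Testing the variational inequality with controls that differ from
   u_alpha only on a subset gives, almost everywhere,
     (q_alpha + alpha u_alpha) (v - u_alpha) >= 0   for every admissible v.
   Adding the inequalities for alpha and 0 bounds the integrand of
     |T (u_alpha - u_0)|^2 = \int (q_alpha - q_0) (u_alpha - u_0)
   by alpha u_alpha (u_0 - u_alpha) - |q_0| |u_alpha - u_0|.  This is at most
   2 alpha M^2, and it is nonpositive both where |q_0| > alpha M and, by the
   sigma-condition, off {alpha a < - q_alpha < alpha b}.  So either measure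
   condition gives |T (u_alpha - u_0)|^2 = O(alpha^(kappa + 1)), and
   |q_alpha - q_0| is almost everywhere of order alpha^((kappa + 1) / 2), by the
   L^oo bound on T^*.  Each of the two sets is then almost contained in the
   other one, for comparable parameters. *)

Set Implicit Arguments.
Unset Strict Implicit.
Unset Printing Implicit Defensive.

Import Order.TTheory GRing.Theory Num.Theory.
Import numFieldNormedType.Exports.

Local Open Scope classical_set_scope.
Local Open Scope ring_scope.

(** * Square-integrable functions and their pairing *)

Section L2_theory.
Context d {X : measurableType d} {R : realType}.
Variable mu : {measure set X -> \bar R}.
Implicit Types u v w : L2 mu.

Lemma L2_addE u v x : (u + v) x = u x + v x. Proof. by []. Qed.
Lemma L2_oppE u x : (- u) x = - u x. Proof. by []. Qed.
Lemma L2_scaleE (k : R) u x : (k *: u) x = k * u x. Proof. by []. Qed.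

Lemma L2_mul_integrable u v :
  mu.-integrable setT (EFin \o (fun x => u x * v x)).
Proof. by apply/Lfun1_integrable/Lfun2_mul_Lfun1; exact: LfunP. Qed.

Lemma L2_dotC u v : L2_dot u v = L2_dot v u.
Proof. by apply: eq_Rintegral => x _; rewrite mulrC. Qed.

Lemma L2_dotDr u v w : L2_dot u (v + w) = L2_dot u v + L2_dot u w.
Proof.
rewrite -RintegralD//; [|exact: L2_mul_integrable..].
by apply: eq_Rintegral => x _; rewrite L2_addE mulrDr.
Qed.

Lemma L2_dotZr (k : R) u v : L2_dot u (k *: v) = k * L2_dot u v.
Proof.
rewrite -RintegralZl//; last exact: L2_mul_integrable.
by apply: eq_Rintegral => x _; rewrite L2_scaleE mulrCA.
Qed.

Lemma L2_dotNr u v : L2_dot u (- v) = - L2_dot u v.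
Proof. by rewrite -scaleN1r L2_dotZr mulN1r. Qed.

Lemma L2_dotDl u v w : L2_dot (u + v) w = L2_dot u w + L2_dot v w.
Proof. by rewrite L2_dotC L2_dotDr !(L2_dotC w). Qed.

Lemma L2_dotZl (k : R) u v : L2_dot (k *: u) v = k * L2_dot u v.
Proof. by rewrite L2_dotC L2_dotZr L2_dotC. Qed.

Lemma L2_dotNl u v : L2_dot (- u) v = - L2_dot u v.
Proof. by rewrite L2_dotC L2_dotNr L2_dotC. Qed.

Lemma L2_norm_sqr u : L2_norm u ^+ 2 = L2_dot u u.
Proof.
apply: EFin_inj.
rewrite -powR_mulrn ?fine_ge0 ?Lnorm_ge0// -poweR_EFin (finite_norm_fine u).
rewrite poweR_Lnorm// /L2_dot /Rintegral fineK; last first.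
  exact: integrable_fin_num (L2_mul_integrable u u).
by apply: eq_integral => x _ /=; rewrite powR_mulrn// real_normK ?num_real.
Qed.

Lemma L2_dot_eq0 u : L2_dot u u = 0 -> \forall x \ae mu, u x = 0.
Proof.
rewrite -L2_norm_sqr => /eqP; rewrite sqrf_eq0 => /eqP /fine_Lnormr_eq0.
by apply: filterS => x /(_ I).
Qed.

End L2_theory.

(** * Essential bounds and integral estimates *)

Section ae_bounds.
Context d {X : measurableType d} {R : realType}.
Variable mu : {measure set X -> \bar R}.

Lemma ae_le_Linf_norm (f : X -> R) : Linf mu f ->
  \forall x \ae mu, `|f x| <= Linf_norm mu f.
Proof.
rewrite /Linf => /andP[_]; rewrite inE/= /finite_norm => fin.
(* The L^oo norm is an essential supremum only if [mu setT] is positive; for a null measure every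
   property holds almost everywhere. *)
have [mu0|mu0] := eqVneq (mu setT) 0%E; first by exists setT.
have -> : Linf_norm mu f = fine (ess_sup mu (abse \o (EFin \o f))).
  by rewrite /Linf_norm unlock lt0e mu0 measure_ge0.
have : ('N[mu]_+oo[EFin \o f] \is a fin_num)%E.
  by rewrite ge0_fin_numE ?Lnorm_ge0.
rewrite unlock lt0e mu0 measure_ge0/= => /fineK E.
have := ess_sup_ge mu (abse \o (EFin \o f)).
by apply: filterS => x /=; rewrite -E lee_fin.
Qed.

(** This makes pasted controls, and the bounds [a] and [b] themselves, available as test functions
    in L^2. *)
Lemma bounded_Lfun2 (f : X -> R) (M : R) : mu setT \is a fin_num ->
  measurable_fun setT f -> (\forall x \ae mu, `|f x| <= M) ->
  f \in Lfun mu 2%:R%:E.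
Proof.
move=> mufin mf fM.
apply: (@Lfun_subset _ _ _ mu 2%:R%:E +oo%E (lee1n 2) (leey _) mufin (leey _)).
apply/andP; split; rewrite inE//= /finite_norm unlock.
case: ifPn => // _; apply: (@le_lt_trans _ _ M%:E); last by rewrite ltry.
by apply/ess_supP; apply: filterS fM => x /=; rewrite lee_fin.
Qed.

(** The function [f] may change sign, but its positive part obeys the same bound, since [C * \1_E]
    is nonnegative. *)
Lemma Rintegral_le_measure (f : X -> R) (E : set X) (C : R) :
  mu.-integrable setT (EFin \o f) -> measurable E -> 0 <= C ->
  (\forall x \ae mu, f x <= C * \1_E x) ->
  ((\int[mu]_x f x)%:E <= C%:E * mu E)%E.
Proof.
move=> intf mE C0 fE.
have mf : measurable_fun setT f by apply/measurable_EFinP; case/integrableP: intf.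
rewrite /Rintegral fineK; last exact: integrable_fin_num.
have := @integral_indic _ _ _ mu setT measurableT E mE; rewrite setIT => <-.
rewrite -ge0_integralZl//; last first.
  by apply/measurable_EFinP; exact: measurable_indic.
apply: (@le_trans _ _ (\int[mu]_x ((EFin \o f)^\+ x))%E).
  rewrite integralE -[leRHS]sube0 leeB//; exact: integral_ge0.
apply: ae_ge0_le_integral => //=.
- by apply: measurable_funepos; exact/measurable_EFinP.
- by move=> x _; rewrite lee_fin mulr_ge0.
- by apply: measurable_funeM; apply/measurable_EFinP; exact: measurable_indic.
- apply: filterS fE => x fx _; rewrite funeposE ge_max lee_fin fx/= lee_fin.
  by rewrite mulr_ge0.
Qed.

End ae_bounds.

(** * First-order optimality in integrated form *)

Section variational_inequality.
Context d {X : measurableType d} {R : realType}.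
Variable mu : {measure set X -> \bar R}.
Variables (H : completeNormedModType R) (dot : {dot H for idfun}).
Hypothesis hdot : induces_norm dot.
Variables (T : {linear L2 mu -> H}) (z : H) (a b : X -> R).

Lemma dotC (x y : H) : dot x y = dot y x.
Proof. by rewrite hermC expr0 mul1r. Qed.

Lemma dotZr (k : R) (x y : H) : dot x (k *: y) = k * dot x y.
Proof. by rewrite linearZr. Qed.

Lemma norm_sqrD (x y : H) : `|x + y| ^+ 2 = `|x| ^+ 2 + 2 * dot x y + `|y| ^+ 2.
Proof.
by rewrite -!hdot linearDl/= !linearDr/= (dotC y x); ring.
Qed.

Lemma objective_expand (alpha t : R) (u h : L2 mu) :
  objective T z alpha (u + t *: h) = objective T z alpha u
  + t * (dot (T u - z) (T h) + alpha * L2_dot u h)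
  + t ^+ 2 * (2^-1 * `|T h| ^+ 2 + alpha / 2 * L2_dot h h).
Proof.
rewrite /objective !L2_norm_sqr linearD linearZ/= addrAC.
rewrite (norm_sqrD (T u - z)) normrZ exprMn real_normK ?num_real//.
rewrite dotZr !(L2_dotDl, L2_dotDr, L2_dotZl, L2_dotZr) (L2_dotC h u).
by field.
Qed.

Lemma admissible_segment (u v : L2 mu) (t : R) : 0 <= t <= 1 ->
  admissible a b u -> admissible a b v -> admissible a b (u + t *: (v - u)).
Proof.
move=> t01; apply: filterS2 => x /andP[au ub] /andP[av vb].
by rewrite L2_addE L2_scaleE L2_addE L2_oppE; apply/andP; split; nra.
Qed.

(** Minimality along the segment from [u] to [v] gives [0 <= A + t * D] for [0 < t <= 1], which
    prevents [A] from being negative. *)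
Lemma solution_variational (alpha : R) (u q v : L2 mu) :
  (forall h, L2_dot q h = dot (T u - z) (T h)) ->
  is_solution a b T z alpha u -> admissible a b v ->
  0 <= L2_dot (q + alpha *: u) (v - u).
Proof.
move=> hq [uad umin] vad; rewrite L2_dotDl L2_dotZl hq.
set A := _ + _; pose D := 2^-1 * `|T (v - u)| ^+ 2 + alpha / 2 * L2_dot (v - u) (v - u).
have key t : 0 < t <= 1 -> 0 <= A + t * D.
  move=> /andP[t0 t1].
  have /umin : admissible a b (u + t *: (v - u)).
    by apply: admissible_segment; rewrite // ltW.
  rewrite objective_expand -/A -/D -addrA lerDl => ge0.
  by rewrite -(pmulr_rge0 _ t0) mulrDr mulrA -expr2.
rewrite leNgt; apply/negP => A0.
have D0 := normr_ge0 D; have DD := ler_norm D.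
have den : 0 < `|D| - A by lra.
(* At this step size, [A + t * D] multiplied by [|D| - A] equals [A * (|D| - D) - A ^ 2], which is
   negative when [A < 0]. *)
have /key : 0 < - A / (`|D| - A) <= 1.
  by rewrite divr_gt0/= ?ler_pdivrMr//; lra.
rewrite -(pmulr_lge0 _ den) mulrDl mulrAC divfK ?gt_eqF//; nra.
Qed.

End variational_inequality.

(** * Optimality localized almost everywhere *)

Section pointwise_variational_inequality.
Context d {X : measurableType d} {R : realType}.
Variable mu : {measure set X -> \bar R}.
Hypothesis mufin : mu setT \is a fin_num.

Lemma ae_eq0_of_L2_dot_le0 (u v : L2 mu) :
  (forall x, 0 <= u x * v x) -> L2_dot u v <= 0 ->
  \forall x \ae mu, u x * v x = 0.
Proof.
move=> uv0 duv.
have : (\int[mu]_x `|(u x * v x)%:E| = 0)%E.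
  under eq_integral do rewrite gee0_abs ?lee_fin//.
  rewrite -[LHS]fineK; last exact: integrable_fin_num (L2_mul_integrable u v).
  congr EFin; apply/eqP; rewrite eq_le duv/=.
  by apply: Rintegral_ge0 => x _.
have /integrableP[mf _] := L2_mul_integrable u v.
by move/(ae_eq_integral_abs mu measurableT mf); apply: filterS => x /(_ I)[].
Qed.

Variables (a b : X -> R) (M : R).
Hypotheses (aM : \forall x \ae mu, `|a x| <= M).
Hypotheses (bM : \forall x \ae mu, `|b x| <= M).

Lemma admissible_bounded (u : L2 mu) : admissible a b u ->
  \forall x \ae mu, `|u x| <= M.
Proof.
move=> uad; apply: filterS3 uad aM bM => x.
by rewrite !ler_norml => /andP[? ?] /andP[? ?] /andP[? ?]; apply/andP; split; lra.
Qed.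

(* The test function [w] equals [v] where [g (v - u) < 0] and [u] elsewhere. *)
Lemma ae_ge0_of_variational (g u v : L2 mu) :
  admissible a b u -> admissible a b v ->
  (forall w : L2 mu, admissible a b w -> 0 <= L2_dot g (w - u)) ->
  \forall x \ae mu, 0 <= g x * (v x - u x).
Proof.
move=> uad vad vi.
pose A x := g x * (v x - u x) < 0.
pose f x := if A x then v x else u x.
have mf : measurable_fun setT f.
  apply: measurable_fun_ifT => //.
  apply: measurable_fun_ltr; last exact: measurable_cst.
  by apply: measurable_funM => //; apply: measurable_funB.
have fab : \forall x \ae mu, a x <= f x <= b x.
  by apply: filterS2 uad vad => x; rewrite /f; case: ifP.
have fL2 : f \in Lfun mu 2%:R%:E.
  apply: (bounded_Lfun2 (M := M)) mf _ => //.
  apply: filterS2 (admissible_bounded uad) (admissible_bounded vad) => x.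
  by rewrite /f; case: ifP.
pose w : L2 mu := Lfun_Sub (lee1n 2) fL2.
(* The product of [g] and [u - w] is positive where [A] holds and zero elsewhere. Its integral is at
   most zero, so [A] fails almost everywhere. *)
have := vi w fab; rewrite -oppr_le0 -L2_dotNr opprB => /ae_eq0_of_L2_dot_le0.
have h x : (u - w) x = u x - f x by [].
have pos x : 0 <= g x * (u - w) x.
  by rewrite h /f /A; case: ifPn => [/ltW|_]; rewrite ?subrr ?mulr0//; lra.
move=> /(_ pos); apply: filterS => x; rewrite h /f /A.
by case: ifPn => [l|]; [lra | rewrite -leNgt].
Qed.

End pointwise_variational_inequality.

Lemma le_measure_ae d {X : measurableType d} {R : realType}
    (mu : {measure set X -> \bar R}) (A E : set X) :
  measurable A -> measurable E -> (\forall x \ae mu, A x -> E x) ->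
  (mu A <= mu E)%E.
Proof.
move=> mA mE [N [mN N0 AEN]].
apply: (@le_trans _ _ (mu (E `|` N))).
  apply: le_measure; rewrite ?inE//; first exact: measurableU.
  move=> x Ax; have [Ex|nEx] := pselect (E x); first by left.
  by right; apply: AEN => /(_ Ax).
rewrite (le_trans (measureU2 _ mE mN))// -[leRHS]adde0 leeD2l//.
by have := lexx (0%E : \bar R); rewrite -{1}N0.
Qed.

Lemma sqr_EFin_le0 (R : realDomainType) (r : R) : ((r ^+ 2)%:E <= 0)%E -> r = 0.
Proof.
by rewrite lee_fin => r0; apply/eqP; rewrite -sqrf_eq0 eq_le r0 sqr_ge0.
Qed.

(** * Error in the state caused by regularization *)

Section regularization_error.
Context d {X : measurableType d} {R : realType}.
Variable mu : {measure set X -> \bar R}.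
Hypothesis mufin : mu setT \is a fin_num.
Variables (H : completeNormedModType R) (dot : {dot H for idfun}).
Hypothesis hdot : induces_norm dot.
Variables (T : {linear L2 mu -> H}) (z : H) (a b : X -> R).
Hypotheses (ma : measurable_fun setT a) (mb : measurable_fun setT b).
Variable M : R.
Hypothesis M0 : 0 < M.
Hypothesis aM : \forall x \ae mu, `|a x| <= M.
Hypothesis bM : \forall x \ae mu, `|b x| <= M.
Variables (ubar q : R -> L2 mu).
Hypothesis hubar : forall alpha, 0 <= alpha ->
  is_solution a b T z alpha (ubar alpha).
Hypothesis hq : forall alpha h, 0 <= alpha ->
  L2_dot (q alpha) h = dot (T (ubar alpha) - z) (T h).

Let err (alpha : R) := `|T (ubar alpha) - T (ubar 0)|.
Let inactive (alpha : R) := [set x | alpha * a x < - q alpha x < alpha * b x].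
Let small (eps : R) := [set x | 0 <= `|q 0 x| <= eps].

Lemma measurable_inactive alpha : measurable (inactive alpha).
Proof.
rewrite -[inactive _]setTI.
have -> : inactive alpha =
    (fun x => (alpha * a x < - q alpha x) && (- q alpha x < alpha * b x)) @^-1` [set true].
  by [].
have mq : measurable_fun setT (fun x => - q alpha x) by exact: measurable_funN.
apply: measurable_and => //; apply: measurable_fun_ltr => //; exact: measurable_funM.
Qed.

Lemma measurable_small eps : measurable (small eps).
Proof.
rewrite -[small _]setTI.
have -> : small eps = (fun x => `|q 0 x| <= eps) @^-1` [set true].
  by apply/seteqP; split => x; rewrite /small/= normr_ge0.
by apply: measurable_fun_ler => //; exact: measurableT_comp.
Qed.

Lemma ae_variational alpha (v : L2 mu) : 0 <= alpha -> admissible a b v ->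
  \forall x \ae mu, 0 <= (q alpha x + alpha * ubar alpha x) * (v x - ubar alpha x).
Proof.
move=> alpha0 vad; have sol := hubar alpha0.
apply: (ae_ge0_of_variational mufin aM bM (g := q alpha + alpha *: ubar alpha) sol.1 vad).
by move=> w wad; apply: solution_variational sol wad => // h; exact: hq.
Qed.

Lemma err_sqr alpha : 0 <= alpha ->
  err alpha ^+ 2 = L2_dot (q alpha - q 0) (ubar alpha - ubar 0).
Proof.
move=> alpha0; rewrite /err -hdot L2_dotDl L2_dotNl !hq//.
by rewrite -[RHS]linearBl/= opprB addrA subrK (linearB T).
Qed.

Lemma ae_integrand alpha : 0 <= alpha ->
  \forall x \ae mu, (q alpha x - q 0 x) * (ubar alpha x - ubar 0 x) <=
    alpha * ubar alpha x * (ubar 0 x - ubar alpha x)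
    - `|q 0 x| * `|ubar alpha x - ubar 0 x|.
Proof.
move=> alpha0.
have sol0 := hubar (lexx 0); have sol := hubar alpha0.
apply: filterS2 (ae_variational alpha0 sol0.1) (ae_variational (lexx 0) sol.1) => x.
(* By [h2], [q 0 x * (ubar alpha x - ubar 0 x)] is nonnegative, hence equal to the product of the
   absolute values. *)
rewrite -normrM mul0r addr0 => h1 h2.
by rewrite ger0_norm//; lra.
Qed.

(** Shared by both measure conditions: [E] contains almost every point where the bound of
    [ae_integrand] is positive. *)
Lemma err_sqr_le alpha C (E : set X) : 0 <= alpha -> 0 <= C -> measurable E ->
  (\forall x \ae mu, alpha * ubar alpha x * (ubar 0 x - ubar alpha x)
    - `|q 0 x| * `|ubar alpha x - ubar 0 x| <= C * \1_E x) ->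
  ((err alpha ^+ 2)%:E <= C%:E * mu E)%E.
Proof.
move=> alpha0 C0 mE h; rewrite err_sqr//.
apply: Rintegral_le_measure => //; first exact: L2_mul_integrable.
by apply: filterS2 (ae_integrand alpha0) h => x; exact: le_trans.
Qed.

(** Where [|q 0 x|] exceeds [alpha * M], the negative term absorbs the other one, which is at most
    [alpha * M * |ubar alpha x - ubar 0 x|]. *)
Lemma err_sqr_le_small alpha : 0 <= alpha ->
  ((err alpha ^+ 2)%:E <= (2 * alpha * M ^+ 2)%:E * mu (small (alpha * M)))%E.
Proof.
move=> alpha0; apply: err_sqr_le => //.
- by rewrite mulr_ge0 ?sqr_ge0// mulr_ge0.
- exact: measurable_small.
have sol0 := hubar (lexx 0); have sol := hubar alpha0.
apply: filterS2 (admissible_bounded aM bM sol.1) (admissible_bounded aM bM sol0.1) => x u1 u0.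
have le1 : alpha * ubar alpha x * (ubar 0 x - ubar alpha x) <=
    alpha * M * `|ubar alpha x - ubar 0 x|.
  rewrite -mulrA -mulrA ler_wpM2l// (le_trans (ler_norm _))// normrM distrC.
  by rewrite ler_wpM2r.
have le2 : `|ubar alpha x - ubar 0 x| <= 2 * M.
  by rewrite (le_trans (ler_normB _ _))//; lra.
have N0 := normr_ge0 (ubar alpha x - ubar 0 x).
have q0 := normr_ge0 (q 0 x).
rewrite indicE; case: (boolP (x \in _)) => xs.
  rewrite mulr1 (@le_trans _ _ (alpha * M * `|ubar alpha x - ubar 0 x|))//.
    by rewrite (le_trans _ le1)// gerBl mulr_ge0.
  rewrite [leRHS](_ : _ = alpha * M * (2 * M)); last by ring.
  by rewrite ler_wpM2l// mulr_ge0// (le_trans _ u0).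
have lt0 : alpha * M < `|q 0 x|.
  by move/negP: xs; rewrite inE /small/= normr_ge0/= => /negP; rewrite -ltNge.
by rewrite mulr0 subr_le0 (le_trans le1)// ler_wpM2r// ltW.
Qed.

(* Off the inactive set, [ubar alpha] is [a] or [b]; as [a < 0 < b], the
   product [ubar alpha * (ubar 0 - ubar alpha)] is then nonpositive. *)
Lemma err_sqr_le_inactive sigma alpha : 0 < sigma -> 0 < alpha ->
  (\forall x \ae mu, (a x <= - sigma < 0) && (0 < sigma <= b x)) ->
  ((err alpha ^+ 2)%:E <= (2 * alpha * M ^+ 2)%:E * mu (inactive alpha))%E.
Proof.
move=> sigma0 alpha_gt0 sig; have alpha0 := ltW alpha_gt0.
apply: err_sqr_le => //.
- by rewrite mulr_ge0 ?sqr_ge0// mulr_ge0.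
- exact: measurable_inactive.
have sol0 := hubar (lexx 0); have sol := hubar alpha0.
have ab : \forall x \ae mu, a x <= b x.
  by apply: filterS sig => x /andP[/andP[? ?] /andP[? ?]]; lra.
pose A : L2 mu := Lfun_Sub (lee1n 2) (bounded_Lfun2 mufin ma aM).
pose B : L2 mu := Lfun_Sub (lee1n 2) (bounded_Lfun2 mufin mb bM).
have Aad : admissible a b A by apply: filterS ab => x h; rewrite lexx.
have Bad : admissible a b B by apply: filterS ab => x h; rewrite lexx andbT.
have bnd : \forall x \ae mu, `|ubar alpha x| <= M /\ `|ubar 0 x| <= M.
  apply: filterS2 (admissible_bounded aM bM sol.1) (admissible_bounded aM bM sol0.1) => x //.
have uab : \forall x \ae mu, (a x <= ubar alpha x <= b x) /\ (a x <= ubar 0 x <= b x).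
  by apply: filterS2 sol.1 sol0.1 => x.
have vi : \forall x \ae mu, 0 <= (q alpha x + alpha * ubar alpha x) * (a x - ubar alpha x) /\
   0 <= (q alpha x + alpha * ubar alpha x) * (b x - ubar alpha x).
  by apply: filterS2 (ae_variational alpha0 Aad) (ae_variational alpha0 Bad) => x.
near=> x.
have [u1 u0] : `|ubar alpha x| <= M /\ `|ubar 0 x| <= M by near: x.
have [/andP[a1 b1] /andP[a0 b0]] : (a x <= ubar alpha x <= b x) /\ (a x <= ubar 0 x <= b x) by near: x.
have [via vib] : 0 <= (q alpha x + alpha * ubar alpha x) * (a x - ubar alpha x) /\
   0 <= (q alpha x + alpha * ubar alpha x) * (b x - ubar alpha x) by near: x.
have /andP[/andP[sa _] /andP[_ sb]] : (a x <= - sigma < 0) && (0 < sigma <= b x) by near: x.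
apply: (@le_trans _ _ (alpha * (ubar alpha x * (ubar 0 x - ubar alpha x)))).
  by rewrite -mulrA gerBl mulr_ge0.
rewrite indicE; case: (boolP (x \in _)) => xs.
  rewrite mulr1 [leRHS](_ : _ = alpha * (2 * M ^+ 2)); last by ring.
  rewrite ler_wpM2l//; move: u1 u0; rewrite !ler_norml => /andP[? ?] /andP[? ?]; nra.
rewrite mulr0 pmulr_rle0//.
(* Here [q alpha x + alpha * ubar alpha x] is at least [alpha * (ubar alpha x - a x)], so [via]
   forces [ubar alpha x = a x]; the case of [b] is symmetric. *)
have [qa|qa] := leP (- q alpha x) (alpha * a x).
  suff -> : ubar alpha x = a x by nra.
  have : alpha * (ubar alpha x - a x) ^+ 2 <= 0 by nra.
  rewrite pmulr_rle0// => h; apply/eqP; rewrite -subr_eq0 -sqrf_eq0 eq_le h.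
  exact: sqr_ge0.
have qb : alpha * b x <= - q alpha x.
  by move/negP: xs; rewrite inE /inactive/= qa/= => /negP; rewrite -leNgt.
suff -> : ubar alpha x = b x by nra.
have : alpha * (ubar alpha x - b x) ^+ 2 <= 0 by nra.
rewrite pmulr_rle0// => h; apply/eqP; rewrite -subr_eq0 -sqrf_eq0 eq_le h.
exact: sqr_ge0.
Unshelve. all: by end_near. Qed.

(** * Uniform closeness of the adjoint states and comparison of the sets *)

Variables (Ts : H -> L2 mu) (c : R).
Hypothesis hTs : is_adjoint dot T Ts.
Hypothesis c0 : 0 < c.
Hypothesis Ts_Linf : forall v, range T v ->
  Linf mu (Ts v) /\ Linf_norm mu (Ts v) <= c * `|v|.

(** [q alpha - q 0] and T^* of the state difference represent the same functional, so they agree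
    almost everywhere; the state difference lies in [range T], where the L^oo bound applies. *)
Lemma ae_dist alpha : 0 <= alpha ->
  \forall x \ae mu, `|q alpha x - q 0 x| <= c * err alpha.
Proof.
move=> alpha0; pose v := T (ubar alpha) - T (ubar 0).
have [|TL Tc] := Ts_Linf (v := v).
  by exists (ubar alpha - ubar 0) => //; rewrite linearB.
have : \forall x \ae mu, (q alpha - q 0 - Ts v) x = 0.
  apply: L2_dot_eq0; set w := (X in L2_dot _ X).
  rewrite !(L2_dotDl, L2_dotNl) !hq// hTs -!linearBl/=.
  rewrite [X in dot X](_ : _ = 0) ?linear0l//.
  by rewrite /v opprB [_ + (z - _)]addrA subrK subrr.
apply: filterS2 (ae_le_Linf_norm TL) => x Tx.
rewrite !L2_addE !L2_oppE => /eqP; rewrite subr_eq0 => /eqP ->.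
exact: le_trans Tc.
Qed.

Lemma inactive_le_small alpha : 0 < alpha ->
  (mu (inactive alpha) <= mu (small (alpha * M + c * err alpha)))%E.
Proof.
move=> alpha0.
apply: le_measure_ae; [exact: measurable_inactive|exact: measurable_small|].
apply: filterS3 aM bM (ae_dist (ltW alpha0)) => x.
rewrite /inactive /small/= normr_ge0/= !ler_norml.
move=> /andP[? ?] /andP[? ?] /andP[? ?] /andP[? ?].
by apply/andP; split; nra.
Qed.

Variable sigma : R.
Hypothesis sigma0 : 0 < sigma.
Hypothesis ab_sigma :
  \forall x \ae mu, (a x <= - sigma < 0) && (0 < sigma <= b x).

(** Almost everywhere on [small eps], [|q alpha|] is less than [sigma * alpha], while the
    sigma-condition keeps [alpha * a] and [alpha * b] at least that far from zero. *)
Lemma small_le_inactive alpha eps : 0 < alpha ->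
  eps + c * err alpha < sigma * alpha -> (mu (small eps) <= mu (inactive alpha))%E.
Proof.
move=> alpha0 he.
apply: le_measure_ae; [exact: measurable_small|exact: measurable_inactive|].
apply: filterS2 ab_sigma (ae_dist (ltW alpha0)) => x.
rewrite /inactive /small/= normr_ge0/= !ler_norml.
move=> /andP[/andP[? _] /andP[_ ?]] /andP[? ?] /andP[? ?].
by apply/andP; split; nra.
Qed.

Lemma le_small e1 e2 : e1 <= e2 -> (mu (small e1) <= mu (small e2))%E.
Proof.
move=> e12; apply: le_measure; rewrite ?inE; [exact: measurable_small..|].
by move=> x /andP[h1 h2]; apply/andP; split => //; exact: le_trans e12.
Qed.

(** A null set in either condition makes the error vanish exactly, so that [q alpha] and [q 0] agree
    almost everywhere. *)
Lemma measure_conditions_equiv_pinfty :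
  p0_measure_condition mu (q 0) +oo%E <->
  palpha_measure_condition mu a b (fun alpha => q alpha) +oo%E.
Proof.
split => [[eps eps0 qeps]|[abar abar0 qabar]].
  exists (eps / M); first by rewrite divr_gt0.
  move=> alpha /andP[alpha0]; rewrite ltr_pdivlMr// => /ltW alphaeps.
  have S0 : mu (small (alpha * M)) = 0%E.
    by apply/eqP; rewrite eq_le measure_ge0 andbT -qeps; exact: le_small.
  have := err_sqr_le_small (ltW alpha0); rewrite S0 mule0 => /sqr_EFin_le0 err0.
  apply/eqP; rewrite eq_le measure_ge0 andbT -S0.
  by have := inactive_le_small alpha0; rewrite err0 mulr0 addr0.
(* The single parameter [abar / 2] suffices: with zero error, any [eps] below [sigma * abar / 2] is
   allowed. *)
exists (sigma * abar / 4); first by rewrite divr_gt0// mulr_gt0.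
have abar2 : 0 < abar / 2 < abar by lra.
have I0 : mu (inactive (abar / 2)) = 0%E by exact: qabar.
have /andP[abar20 _] := abar2.
have := err_sqr_le_inactive sigma0 abar20 ab_sigma.
rewrite I0 mule0 => /sqr_EFin_le0 err0.
apply/eqP; rewrite eq_le measure_ge0 andbT -[leRHS]I0.
apply: small_le_inactive => //; rewrite err0 mulr0 addr0.
have := mulr_gt0 sigma0 abar0; lra.
Qed.

(* The error is O(alpha^((k + 1) / 2)), hence O(alpha) as [1 <= k]. *)
Lemma p0_imp_palpha (k : R) : 1 <= k ->
  p0_measure_condition mu (q 0) k%:E ->
  palpha_measure_condition mu a b (fun alpha => q alpha) k%:E.
Proof.
move=> k1 [C C0 hC].
(* The square of the error is at most [D ^ 2 * alpha ^ (k + 1)]. Taking 1 for the threshold below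
   gives [alpha ^ k <= alpha], hence an error of at most [alpha * D]. *)
pose D := Num.sqrt (2 * M ^+ 2 * C * M `^ k).
have D0 : 0 <= D by exact: sqrtr_ge0.
exists 1 => //; exists (C * (M + c * D) `^ k) => alpha /andP[alpha0 alpha1].
have alpha_ge0 := ltW alpha0; have M_ge0 := ltW M0; have c_ge0 := ltW c0.
have e0 : 0 <= err alpha by exact: normr_ge0.
have errD : err alpha <= alpha * D.
  have := err_sqr_le_small (ltW alpha0).
  have := hC _ (mulr_gt0 alpha0 M0); rewrite -/(small _) => hS h.
  have : err alpha ^+ 2 <= 2 * alpha * M ^+ 2 * (C * (alpha * M) `^ k).
    rewrite -lee_fin (le_trans h)// [leRHS]EFinM lee_wpmul2l// lee_fin.
    by rewrite mulr_ge0 ?sqr_ge0// mulr_ge0.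
  rewrite (powRM _ (ltW alpha0) (ltW M0)) => {}h.
  have ak : alpha `^ k <= alpha.
    by rewrite -[leRHS](powRr1 alpha_ge0) ger_powR// alpha0 ltW.
  rewrite -ler_sqr ?nnegrE ?mulr_ge0//.
  rewrite (le_trans h)// exprMn sqr_sqrtr; last first.
    by rewrite !mulr_ge0 ?powR_ge0.
  rewrite [leLHS](_ : _ = alpha `^ k * (alpha * (2 * M ^+ 2 * C * M `^ k))); last by ring.
  rewrite [leRHS](_ : _ = alpha * (alpha * (2 * M ^+ 2 * C * M `^ k))); last by ring.
  by rewrite ler_wpM2r// !mulr_ge0 ?powR_ge0.
have le1 : alpha * M + c * err alpha <= alpha * (M + c * D).
  by rewrite mulrDr lerD2l mulrCA ler_wpM2l.
have pos : 0 < M + c * D by rewrite ltr_pwDl// mulr_ge0.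
rewrite (le_trans (inactive_le_small alpha0))// (le_trans (le_small le1))//.
rewrite (le_trans (hC _ (mulr_gt0 alpha0 pos)))// lee_fin (powRM _ (ltW alpha0) (ltW pos)).
by rewrite mulrAC mulrA.
Qed.

(* As [1 < k], the error O(alpha^((k + 1) / 2)) is o(alpha), so that
   [small (sigma / 3 * alpha)] is almost contained in [inactive alpha]. *)
Lemma palpha_imp_p0 (k : R) : 1 < k ->
  palpha_measure_condition mu a b (fun alpha => q alpha) k%:E ->
  p0_measure_condition mu (q 0) k%:E.
Proof.
move=> k1 [abar abar0 [C0 hC0]].
have M_ge0 := ltW M0; have c_ge0 := ltW c0; have sigma_ge0 := ltW sigma0.
(* The constant [C0] comes without a sign. *)
pose C := Num.max C0 0; have Cge0 : 0 <= C by rewrite le_max lexx orbT.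
have hC alpha : 0 < alpha < abar -> (mu (inactive alpha) <= (C * alpha `^ k)%:E)%E.
  move=> h; rewrite (le_trans (hC0 _ h))// lee_fin ler_wpM2r ?powR_ge0//.
  by rewrite le_max lexx.
pose m := fine (mu setT).
have m0 : 0 <= m by exact: fine_ge0.
(* For [alpha < abar], the square of [c * err alpha] is at most [D2 * alpha ^ (k + 1)]. The number
   [r] is such that [D2 * r <= (sigma / 3) ^ 2], and [alpha < alpha1] gives
   [alpha ^ (k - 1) <= r]. *)
pose D2 := c ^+ 2 * (2 * M ^+ 2 * C).
have D20 : 0 <= D2 by rewrite !mulr_ge0 ?sqr_ge0.
pose r := sigma ^+ 2 / (9 * (D2 + 1)).
have r0 : 0 < r by rewrite divr_gt0 ?exprn_gt0// mulr_gt0//; lra.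
pose alpha1 := Num.min abar (r `^ (k - 1)^-1).
have alpha10 : 0 < alpha1 by rewrite lt_min abar0 powR_gt0.
have err_le alpha : 0 < alpha < alpha1 -> c * err alpha <= sigma / 3 * alpha.
  move=> /andP[alpha0]; have alpha_ge0 := ltW alpha0; have e0 : 0 <= err alpha by exact: normr_ge0.
  rewrite lt_min => /andP[alphaabar alphar].
  have ak : alpha `^ (k - 1) <= r.
    have -> : r = (r `^ (k - 1)^-1) `^ (k - 1).
      by rewrite -powRrM mulVf ?powRr1 ?(ltW r0)// subr_eq0 gt_eqF.
    by rewrite ge0_ler_powR ?nnegrE ?powR_ge0 ?subr_ge0// ltW.
  have ea : 0 < alpha < abar by rewrite alpha0.
  have := err_sqr_le_inactive sigma0 alpha0 ab_sigma.
  move=> h; have {h} : err alpha ^+ 2 <= 2 * alpha * M ^+ 2 * (C * alpha `^ k).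
    rewrite -lee_fin (le_trans h)// [leRHS]EFinM lee_wpmul2l ?hC// lee_fin.
    by rewrite mulr_ge0 ?sqr_ge0// mulr_ge0.
  have -> : alpha `^ k = alpha * alpha `^ (k - 1).
    by rewrite -[X in _ = X * _](powRr1 alpha_ge0) -powRD ?(gt_eqF alpha0) ?implybT// addrC subrK.
  move=> h.
  rewrite -ler_sqr ?nnegrE ?mulr_ge0 ?divr_ge0//.
  have Dr : D2 * alpha `^ (k - 1) <= (sigma / 3) ^+ 2.
    rewrite (le_trans (ler_wpM2l D20 ak))// /r.
    rewrite mulrA ler_pdivrMr; last by nra.
    have := sqr_ge0 sigma; nra.
  rewrite !exprMn (le_trans (ler_wpM2l (sqr_ge0 c) h))//.
  rewrite [leLHS](_ : _ = D2 * alpha `^ (k - 1) * alpha ^+ 2); last first.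
    by rewrite /D2; ring.
  by rewrite ler_wpM2r ?sqr_ge0// -exprMn.
(* The first term serves small [eps]; the second, times [eps ^ k], reaches the total measure [m]
   once [eps] is at least [sigma / 3 * alpha1]. *)
exists (C * (3 / sigma) `^ k + m * ((sigma / 3 * alpha1)^-1) `^ k).
  by rewrite addr_ge0// mulr_ge0 ?powR_ge0.
move=> eps eps0; rewrite -/(small eps) mulrDl EFinD.
have [small_eps|large_eps] := ltP eps (sigma / 3 * alpha1).
  rewrite -[leLHS]adde0 leeD ?lee_fin ?mulr_ge0 ?powR_ge0//.
  (* With this choice [eps + c * err alpha] is at most two thirds of [sigma * alpha]. *)
  pose alpha := 3 / sigma * eps.
  have alphaE : eps = sigma / 3 * alpha by rewrite /alpha; field; rewrite gt_eqF.
  have alpha0 : 0 < alpha by rewrite mulr_gt0// divr_gt0.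
  have alphalt : alpha < alpha1.
    by move: small_eps; rewrite alphaE ltr_pM2l// divr_gt0.
  rewrite (le_trans (small_le_inactive alpha0 _))//.
    have := err_le alpha; rewrite alpha0 alphalt => /(_ isT).
    rewrite {1}alphaE; have := mulr_gt0 sigma0 alpha0; lra.
  rewrite (le_trans (hC _ _))//.
    by rewrite alpha0 (lt_le_trans alphalt)// ge_min lexx.
  by rewrite /alpha powRM ?divr_ge0 ?(ltW eps0)// mulrA.
rewrite -[leLHS]add0e leeD ?lee_fin ?mulr_ge0 ?powR_ge0//.
have s0 : 0 < sigma / 3 * alpha1 by rewrite mulr_gt0// divr_gt0.
apply: (@le_trans _ _ m%:E).
  rewrite /m fineK//; apply: le_measure; rewrite ?inE//; exact: measurable_small.
rewrite lee_fin -[leRHS]mulrA ler_peMr// -powRM ?invr_ge0 ?(ltW s0) ?(ltW eps0)//.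
rewrite [leLHS](_ : 1 = 1 `^ k); last by rewrite powR1.
rewrite ge0_ler_powR ?nnegrE//; first by rewrite (le_trans ler01)// ltW.
  by rewrite mulr_ge0 ?invr_ge0// ltW.
by rewrite ler_pdivlMl// mulr1.
Qed.

End regularization_error.

(** * Dual functionals, bounded domains and the final assembly *)

(** The adjoint [Bs] is specified only on [dual], so this is what allows [Bs (pbar alpha)] to be
    paired with controls. *)
Lemma dual_adjoint_to_dual (R : realType) (V : normedModType R)
    (H : completeNormedModType R) (dot : {dot H for idfun})
    (S : {linear V -> H}) (h : H) : induces_norm dot -> continuous S ->
  dual (adjoint_to_dual dot S h).
Proof.
move=> hdot cS; split=> [k u v|].
  by rewrite /adjoint_to_dual linearP linearDr/= dotZr.
(* Polarization expresses the form by continuous norms. *)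
have -> : adjoint_to_dual dot S h =
    (fun r => 4^-1 * (`|h + S r| ^+ 2 - `|h - S r| ^+ 2)).
  apply/funext => r; rewrite /adjoint_to_dual !(norm_sqrD hdot) normrN linearNr/=.
  by field.
move=> r; apply: cvgM; first exact: cvg_cst.
by apply: cvgB; rewrite !expr2; apply: cvgM; apply: cvg_norm;
  [apply: cvgD|apply: cvgD|apply: cvgB|apply: cvgB]; (exact: cvg_cst || exact: cS).
Qed.

Lemma lebesgue_on_bounded_fin (R : realType) (n : nat)
    (D : set (lebesgue_space R n)) (mD : measurable D) :
  bounded_set (D : set 'rV[R]_n.+1) -> lebesgue_on mD setT \is a fin_num.
Proof.
move=> [K [_ /(_ (K + 1))]]; rewrite ltrDl ltr01 => /(_ isT) DK.
rewrite ge0_fin_numE ?measure_ge0//.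
change (lebesgue_outer (setT `&` D) < +oo)%E; rewrite setTI.
(* Boxes exclude their lower faces, so the lower corner is moved one unit further down. The
   remaining boxes of the cover are degenerate. *)
pose c0 : 'rV[R]_n.+1 * 'rV[R]_n.+1 := (const_mx (- (K + 1) - 1), const_mx (K + 1)).
pose c (k : nat) : 'rV[R]_n.+1 * 'rV[R]_n.+1 := if k is 0%N then c0 else 0.
have cD : (lebesgue_outer D <= \sum_(k <oo) (box_volume (c k))%:E)%E.
  apply: ereal_inf_lbound; exists c => // x Dx; exists 0%N => // i.
  rewrite /= !mxE.
  have := DK x Dx; rewrite /= => xK.
  have : `|x ord0 i| <= K + 1.
    rewrite (le_trans _ xK)//.
    rewrite [leRHS](_ : _ = mx_norm (x : 'rV[R]_n.+1))// mx_normE.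
    exact: (le_bigmax _ (fun i : 'I_1 * 'I_n.+1 => `|x i.1 i.2|%:nng) (ord0, i)).
  by rewrite ler_norml => /andP[? ?]; apply/andP; split; lra.
apply: (le_lt_trans cD).
rewrite (@nneseries_split _ _ _ 1); last first.
  by move=> k _; rewrite lee_fin box_volume_ge0.
rewrite big_nat1 eseries0 ?adde0 ?ltry// => k k1 _.
by case: k k1 => // k _; rewrite box_volume0.
Qed.

Theorem corollary18 (R : realType) (n : nat)
  (Omega : set (lebesgue_space R n)) (mOmega : measurable Omega)
  (bndOmega : bounded_set (Omega : set 'rV[R]_n.+1))
  (H : completeNormedModType R) (dot : {dot H for idfun})
  (hdot : induces_norm dot) (z : H)
  (V : normedModType R)
  (B : {linear L2 (lebesgue_on mOmega) -> V}) (hB : L2_continuous B)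
  (S : {linear V -> H}) (hS : continuous S)
  (T : {linear L2 (lebesgue_on mOmega) -> H}) (hT : L2_continuous T)
  (TSB : forall u, T u = S (B u))
  (Bs : (V -> R) -> L2 (lebesgue_on mOmega)) (hBs : is_adjoint_from_dual B Bs)
  (Ts : H -> L2 (lebesgue_on mOmega)) (hTs : is_adjoint dot T Ts)
  (a b : lebesgue_space R n -> R)
  (ha : Linf (lebesgue_on mOmega) a) (hb : Linf (lebesgue_on mOmega) b)
  (hab : \forall x \ae lebesgue_on mOmega, a x <= b x)
  (ubar : R -> L2 (lebesgue_on mOmega))
  (hubar : forall alpha, 0 <= alpha -> is_solution a b T z alpha (ubar alpha))
  (kappa : \bar R) (hkappa : (1 < kappa)%E)
  (ybar := fun alpha => T (ubar alpha))
  (pbar := fun alpha => adjoint_to_dual dot S (ybar alpha - z))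
  (bang_bang :
    lebesgue_on mOmega [set x | Bs (pbar 0) x = 0] = 0%E)
  (Ts_Linf : exists2 c : R, 0 < c & forall v, range T v ->
    Linf (lebesgue_on mOmega) (Ts v) /\
    Linf_norm (lebesgue_on mOmega) (Ts v) <= c * `|v|)
  (sigma_condition : exists2 sigma : R, 0 < sigma &
    \forall x \ae lebesgue_on mOmega,
      (a x <= - sigma < 0) && (0 < sigma <= b x)) :
  p0_measure_condition (lebesgue_on mOmega) (Bs (pbar 0)) kappa <->
  palpha_measure_condition (lebesgue_on mOmega) a b
    (fun alpha => Bs (pbar alpha)) kappa.
Proof.
have mufin : lebesgue_on mOmega setT \is a fin_num by exact: lebesgue_on_bounded_fin.
have [c c0 hc] := Ts_Linf; have [sigma sigma0 ab_sigma] := sigma_condition.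
have ma : measurable_fun setT a by move: ha => /andP[/[!inE]].
have mb : measurable_fun setT b by move: hb => /andP[/[!inE]].
(* The summand 1 makes [M] positive, so that division by it is possible. *)
pose M : R := `|Linf_norm (lebesgue_on mOmega) a| + `|Linf_norm (lebesgue_on mOmega) b| + 1.
have M0 : 0 < M by rewrite ltr_wpDl// addr_ge0.
have aM : \forall x \ae lebesgue_on mOmega, `|a x| <= M.
  apply: filterS (ae_le_Linf_norm ha) => x /le_trans -> //.
  by rewrite /M (le_trans (ler_norm _))// -addrA lerDl addr_ge0.
have bM : \forall x \ae lebesgue_on mOmega, `|b x| <= M.
  apply: filterS (ae_le_Linf_norm hb) => x /le_trans -> //.
  by rewrite /M (le_trans (ler_norm _))// addrAC lerDr addr_ge0.
pose q alpha := Bs (pbar alpha).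
have hq alpha h : 0 <= alpha -> L2_dot (q alpha) h = dot (T (ubar alpha) - z) (T h).
  by move=> _; rewrite hBs; [rewrite /pbar /adjoint_to_dual -TSB|exact: dual_adjoint_to_dual].
case: kappa hkappa => [k k1|_|//].
- split.
  + apply: (p0_imp_palpha mufin hdot ma mb M0 aM bM hubar hq hTs c0 hc).
    exact: ltW.
  + exact: (palpha_imp_p0 mufin hdot ma mb M0 aM bM hubar hq hTs c0 hc sigma0 ab_sigma).
- exact: (measure_conditions_equiv_pinfty mufin hdot ma mb M0 aM bM hubar hq hTs hc sigma0 ab_sigma).
Qed.
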